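(* Let $(\eta_1,\eta_2,\ldots)$ be any Leja sequence for the closed unit disk $\overline{\mathbb{D}}$, let $l_k^{(N)}(z)=\prod_{j=1,\,j\ne k}^{N}\frac{z-\eta_j}{\eta_k-\eta_j}$ for $1\le k\le N$, and let $\Lambda_N=\sup_{z\in\overline{\mathbb{D}}}\sum_{k=1}^N|l_k^{(N)}(z)|$ be the Lebesgue constant of its first $N$ points. Then for all $N\ge1$, $$\Lambda_N\ \le\ \pi\exp(3\pi)\,N\ =\ O(N).$$
   Context: $\overline{\mathbb{D}}=\{z\in\mathbb{C}:|z|\le 1\}$. A Leja sequence for a compact set $K\subset\mathbb{C}$ is a sequence $(\eta_1,\eta_2,\ldots)$ of points of $K$ with $\eta_1\in\partial K$ and, for all $k\ge2$, $\sup_{z\in K}\prod_{j=1}^{k-1}|z-\eta_j|=\prod_{j=1}^{k-1}|\eta_k-\eta_j|$. *)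

(* Defs.v *)
From HB Require Import structures.
From mathcomp Require Import all_boot all_order all_algebra complex.
From mathcomp Require Import all_classical all_reals all_analysis.

Set Implicit Arguments.
Unset Strict Implicit.
Unset Printing Implicit Defensive.

Import Order.TTheory GRing.Theory Num.Theory numFieldNormedType.Exports.

Local Open Scope classical_set_scope.
Local Open Scope ring_scope.
Local Open Scope complex_scope.

(* [normc z : R] is the real-valued modulus: [`|z| = (normc z)%:C] in R[i]. *)
Notation normc := ComplexField.Normc.normc.

Definition closed_unit_disk (R : realType) : set R[i] :=
  [set z | normc z <= 1].

Arguments closed_unit_disk R : clear implicits.

Definition boundary (T : topologicalType) (K : set T) : set T :=
  closure K `\` K°.

(* Sequences of points are indexed from 1; the value at 0 is never used.
   Suprema are taken in \bar R, so an unbounded set has supremum +oo.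
   The alias R[i]^o is the one carrying the topology of the modulus. *)
Definition leja_sequence (R : realType) (K : set R[i]) (eta : nat -> R[i]) :
    Prop :=
  [/\ forall k, (1 <= k)%N -> K (eta k),
      boundary (K : set R[i]^o) (eta 1%N)
    & forall k, (2 <= k)%N ->
        ereal_sup [set (\prod_(1 <= j < k) normc (z - eta j))%:E | z in K]
        = (\prod_(1 <= j < k) normc (eta k - eta j))%:E].

Definition fund_lagrange (R : realType) (eta : nat -> R[i]) (N k : nat)
    (z : R[i]) : R[i] :=
  \prod_(1 <= j < N.+1 | j != k) ((z - eta j) / (eta k - eta j)).

Definition lebesgue_constant (R : realType) (K : set R[i])
    (eta : nat -> R[i]) (N : nat) : \bar R :=
  ereal_sup
    [set (\sum_(1 <= k < N.+1) normc (fund_lagrange eta N k z))%:E | z in K].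

(* Main.v *)
(* A Leja sequence e_0, e_1, ... of the disk lies on the circle and satisfies
   e_{2j+1} = - e_{2j}, and f_j = e_{2j}^2 is again a Leja sequence.  Let
   Q_N(z) be the sum of the squared moduli of the Lagrange polynomials of the
   first N points.  The parallelogram identity, applied to each pair of
   antipodal nodes, relates Q_{2n} and Q_{2n+1} for e to Q_n and Q_{n+1} for f:
     Q_{2n}(z) <= Q_n(z^2),
     Q_{2n+1}(z) <= 1 + Q_n(z^2) + Q_n(f_n) + Q_{n+1}(z^2) / 2,
   and at the next Leja point Q_N(e_N) <= N.  Since 1 + 1/2 < 2, induction
   yields Q_N <= 2 N, and |l| <= (1 + |l|^2) / 2 bounds the Lebesgue constant
   by 3 N / 2, well below the required bound. *)

Require Import Defs.
From HB Require Import structures.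
From mathcomp Require Import all_boot all_order all_algebra complex.
From mathcomp Require Import all_classical all_reals all_analysis.
From mathcomp Require Import zify ring lra.

Set Implicit Arguments.
Unset Strict Implicit.
Unset Printing Implicit Defensive.

Import Order.TTheory GRing.Theory Num.Theory numFieldNormedType.Exports.

Local Open Scope classical_set_scope.
Local Open Scope ring_scope.

(** * Nodal and Lagrange polynomials under squaring of the nodes *)

Definition nodal (F : fieldType) (e : nat -> F) (n : nat) (z : F) : F :=
  \prod_(j < n) (z - e j).

(** The skipped index stays in the range with factor 1, so that [big_ord_recr] splits off the last
    factor in every case. *)
Definition lagrange (F : fieldType) (e : nat -> F) (n k : nat) (z : F) : F :=
  \prod_(j < n) (if j == k :> nat then 1 else (z - e j) / (e k - e j)).

(** For antipodal pairs (z - e_{2j})(z - e_{2j+1}) = z^2 - e_{2j}^2, so these squares are the nodes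
    in the variable z^2. *)
Definition sqhalf (F : fieldType) (e : nat -> F) (j : nat) : F := e j.*2 ^+ 2.

Lemma nodalS (F : fieldType) (e : nat -> F) n z :
  nodal e n.+1 z = nodal e n z * (z - e n).
Proof. exact: big_ord_recr. Qed.

Lemma lagrangeS (F : fieldType) (e : nat -> F) n k z : k != n ->
  lagrange e n.+1 k z = lagrange e n k z * ((z - e n) / (e k - e n)).
Proof. by move=> kn; rewrite /lagrange big_ord_recr /= eq_sym (negPf kn). Qed.

Lemma lagrange_last (F : fieldType) (e : nat -> F) n z :
  lagrange e n.+1 n z = nodal e n z / nodal e n (e n).
Proof.
rewrite /lagrange big_ord_recr /= eqxx mulr1 -prodf_div.
by apply: eq_bigr => j _; rewrite ltn_eqF.
Qed.

Lemma nodal_neq (F : fieldType) (e : nat -> F) n z j :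
  nodal e n z != 0 -> (j < n)%N -> z - e j != 0.
Proof. by move=> /prodf_neq0 nz jn; exact: (nz (Ordinal jn)). Qed.

Lemma nodal_double (F : fieldType) (e : nat -> F) n z :
  (forall j, (j < n)%N -> e j.*2.+1 = - e j.*2) ->
  nodal e n.*2 z = nodal (sqhalf e) n (z ^+ 2).
Proof.
elim: n => [|n IHn] pair_e; first by rewrite /nodal !big_ord0.
rewrite doubleS !nodalS IHn => [|j jn]; last by rewrite pair_e// ltnW.
by rewrite pair_e// /sqhalf; ring.
Qed.

(* The factor 1 for n <= i makes the statement provable by induction on n. *)
Lemma lagrange_double (F : fieldType) (e : nat -> F) (n i k : nat) z :
  (forall j, e j.*2.+1 = - e j.*2) ->
  (forall j, (j < n)%N -> j != i -> e k ^+ 2 - e j.*2 ^+ 2 != 0) ->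
  k = i.*2 \/ k = i.*2.+1 -> e k != 0 ->
  2%:R != 0 :> F ->
  lagrange e n.*2 k z =
    lagrange (sqhalf e) n i (z ^+ 2) *
    (if (i < n)%N then (z + e k) / (2 * e k) else 1).
Proof.
move=> pair_e neq ki ek0 two0.
have ek2 : e k ^+ 2 = e i.*2 ^+ 2 by case: ki => ->; rewrite ?pair_e ?sqrrN.
elim: n neq => [|n IHn] neq; first by rewrite /lagrange !big_ord0 mulr1.
rewrite /lagrange doubleS !big_ord_recr /= -!/(lagrange _ _ _ _).
rewrite IHn => [|j jn]; last by apply: neq; rewrite ltnW.
(* In the pair containing [e k], the node itself gives 1 and its antipode gives (z + e_k) / (2 e_k).
   Any other pair collapses to one factor in z^2. *)
have [ni|ni] := eqVneq n i.
  subst i; rewrite ltnn ltnSn mulr1.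
  case: ki => ki; subst k; rewrite eqxx.
    by rewrite gtn_eqF// pair_e opprK mulr1 -mulr2n mulr_natl.
  by rewrite ltn_eqF// pair_e -opprD -mulr2n mulr1 mulrN mulr_natl.
have -> : (n.*2 == k) = false by apply/negbTE; lia.
have -> : (n.*2.+1 == k) = false by apply/negbTE; lia.
have -> : (i < n.+1)%N = (i < n)%N by rewrite ltnS leq_eqVlt eq_sym (negPf ni).
have := neq n (ltnSn _) ni.
rewrite pair_e /sqhalf -ek2 subr_sqr mulf_eq0 negb_or => /andP[kn0 kn1].
set a := lagrange _ _ _ _; set b := if _ then _ else _.
by field; rewrite kn0 kn1.
Qed.

(** (z - e_j) l_j(z) is the nodal polynomial times a constant independent of z; comparing z = w with
    z = c eliminates that constant. *)
Lemma lagrange_gap (F : fieldType) (e : nat -> F) n j w c :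
  (j < n)%N -> nodal e n c != 0 ->
  lagrange e n j w * ((e j - w) / (e j - c)) =
  nodal e n w / nodal e n c * lagrange e n j c.
Proof.
move=> jn c0; pose P z := \prod_(i < n | i != Ordinal jn) (z - e i).
have lagE z : lagrange e n j z = P z / P (e j).
  rewrite /lagrange -prodf_div [RHS]big_mkcond /=; apply: eq_bigr => i _.
  by rewrite -val_eqE /=; case: eqP.
have nodE z : nodal e n z = (z - e j) * P z.
  by rewrite /nodal (bigD1 (Ordinal jn)).
have := c0; rewrite !lagE !nodE mulf_eq0 negb_or => /andP[cj0 Pc0].
set q := (P (e j))^-1.
have jc0 : e j - c != 0 by rewrite -opprB oppr_eq0.
by field; rewrite cj0 Pc0.
Qed.

Lemma sum_double (V : nmodType) (F : nat -> V) n :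
  \sum_(k < n.*2) F k = \sum_(k < n) (F k.*2 + F k.*2.+1).
Proof.
elim: n => [|n IHn]; first by rewrite !big_ord0.
by rewrite doubleS !big_ord_recr /= IHn addrA.
Qed.

(** * Complex modulus and the parallelogram identity *)

Lemma normc_ge0 (R : rcfType) (x : R[i]) : 0 <= normc x.
Proof. by case: x => a b; exact: sqrtr_ge0. Qed.

Lemma sqr_normc_parallelogram (R : rcfType) (x y : R[i]) :
  normc (x + y) ^+ 2 + normc (x - y) ^+ 2 = 2 * (normc x ^+ 2 + normc y ^+ 2).
Proof.
case: x y => [a b] [c d] /=.
rewrite !sqr_sqrtr ?addr_ge0 ?sqr_ge0//; ring.
Qed.

Lemma sqr_normcD_le (R : rcfType) (x y : R[i]) :
  normc (x + y) ^+ 2 <= 2 * (normc x ^+ 2 + normc y ^+ 2).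
Proof. by rewrite -sqr_normc_parallelogram lerDl sqr_ge0. Qed.

Lemma normcX (R : rcfType) (x : R[i]) n : normc (x ^+ n) = normc x ^+ n.
Proof.
elim: n => [|n IHn]; first by rewrite !expr0 ComplexField.Normc.normc1.
by rewrite !exprS ComplexField.Normc.normcM IHn.
Qed.

Lemma normc_prod (R : rcfType) (I : Type) (r : seq I) (P : pred I)
    (F : I -> R[i]) :
  normc (\prod_(i <- r | P i) F i) = \prod_(i <- r | P i) normc (F i).
Proof.
apply: (big_morph _ (@ComplexField.Normc.normcM R)).
exact: ComplexField.Normc.normc1.
Qed.

Lemma normc_eq0 (R : rcfType) (x : R[i]) : (normc x == 0) = (x == 0).
Proof.
apply/eqP/eqP => [/ComplexField.Normc.eq0_normc//|->].
exact: ComplexField.Normc.normc0.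
Qed.

(** By the parallelogram identity, |x + c|^2 = 2 (|x|^2 + 1) - |x - c|^2 <= 4 - 4. *)
Lemma antipode_of_far (R : rcfType) (c x : R[i]) :
  normc c = 1 -> normc x <= 1 -> 2 <= normc (x - c) -> x = - c.
Proof.
move=> c1 x1 far; apply/eqP; rewrite -addr_eq0 -normc_eq0 -sqrf_eq0.
have := sqr_normc_parallelogram x c; rewrite c1.
have := normc_ge0 x; have := sqr_ge0 (normc (x + c)).
by move=> ? ? ?; apply/eqP; nra.
Qed.

(** * Leja prefixes of the disk: antipodal pairs and squaring *)

(** Finite prefixes permit strong induction on the length. The first point is placed on the circle
    explicitly, since maximality of an empty product says nothing. *)
Definition leja_prefix (R : rcfType) (n : nat) (e : nat -> R[i]) : Prop :=
  [/\ normc (e 0%N) = 1,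
      forall k, (k < n)%N -> normc (e k) <= 1
    & forall k z, (k < n)%N -> normc z <= 1 ->
        normc (nodal e k z) <= normc (nodal e k (e k))].

Lemma leja_prefixW (R : rcfType) n m (e : nat -> R[i]) :
  (n <= m)%N -> leja_prefix m e -> leja_prefix n e.
Proof.
move=> nm [e0 e1 emax]; split=> // k.
  by move=> kn; apply/e1/(leq_trans kn).
by move=> z kn; apply/emax/(leq_trans kn).
Qed.

(** Every point of the disk is the square of a point of the disk, so maximality of [e] at index 2k
    becomes maximality of the squares at index k. *)
Lemma leja_prefix_half (R : rcfType) m (e : nat -> R[i]) :
  leja_prefix m.*2.+1 e -> (forall j, (j < m)%N -> e j.*2.+1 = - e j.*2) ->
  leja_prefix m.+1 (sqhalf e).
Proof.
move=> [e0 e1 emax] pair_e; split.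
- by rewrite /sqhalf normcX e0 expr1n.
- move=> k km; rewrite /sqhalf normcX exprn_ile1 ?normc_ge0// e1//.
  by rewrite ltnS leq_double.
move=> k z km z1; rewrite -[z]sqr_sqrtc.
have pair_k j : (j < k)%N -> e j.*2.+1 = - e j.*2.
  by move=> jk; apply/pair_e/(leq_trans jk).
rewrite /sqhalf -!nodal_double//; apply: emax; first by rewrite ltnS leq_double.
by rewrite -(@expr_le1 _ 2) ?normc_ge0// -normcX sqr_sqrtc.
Qed.

(* Index 2j+1: the maximum of |f-nodal(z^2)| * |z - e_{2j}| forces
   |z - e_{2j}| = 2, so no maximum principle is needed.  Index 2j: apply the
   induction hypothesis to the squared sequence. *)
Lemma leja_prefix_pairs (R : rcfType) n (e : nat -> R[i]) : leja_prefix n e ->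
  (forall k, (k < n)%N -> normc (e k) = 1 /\ nodal e k (e k) != 0) /\
  (forall j, (j.*2.+1 < n)%N -> e j.*2.+1 = - e j.*2).
Proof.
elim/ltn_ind: n e => -[_ e _|m IHn e le]; first by split.
have [e1 pair_e] := IHn m (ltnSn m) e (leja_prefixW (leqnSn m) le).
suff [em pm] : (normc (e m) = 1 /\ nodal e m (e m) != 0) /\
    (forall j, j.*2.+1 = m -> e j.*2.+1 = - e j.*2).
  split=> k; rewrite ltnS leq_eqVlt => /orP[/eqP km|].
  - by rewrite km.
  - exact: e1.
  - exact: pm.
  - exact: pair_e.
have := odd_double_half m; case: (odd m) => /=;
  set j := m./2; rewrite ?add1n ?add0n => mE.
- rewrite -mE in e1 pair_e le *.
  have [c1 c0] := e1 _ (ltnSn j.*2).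
  have pairj i : (i < j)%N -> e i.*2.+1 = - e i.*2.
    by move=> ij; apply: pair_e; rewrite !ltnS ltn_double.
  have nodalN : nodal e j.*2 (- e j.*2) = nodal e j.*2 (e j.*2).
    by rewrite !nodal_double// sqrrN.
  (* Let c = e_{2j} and let p be the even polynomial [nodal e j.*2]. The competitor -c gives 2
     |p(c)| <= |p(e_{2j+1})| |e_{2j+1} - c|, and maximality at index 2j gives |p(e_{2j+1})| <=
     |p(c)|. *)
  have [_ /(_ _ (ltnSn _)) em1 /(_ _ (- e j.*2) (ltnSn _))] := le.
  rewrite normcN c1 lexx => /(_ isT); rewrite !nodalS nodalN.
  rewrite !ComplexField.Normc.normcM -opprD normcN -mulr2n -mulr_natl.
  rewrite ComplexField.Normc.normcM c1 mulr1.
  have -> : normc (2 : R[i]) = 2 by rewrite normcMn ComplexField.Normc.normc1.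
  have [_ _ /(_ _ (e j.*2.+1) (ltnW (ltnSn _)) em1) nle far] := le.
  have em : e j.*2.+1 = - e j.*2.
    apply: antipode_of_far => //.
    have p : 0 < normc (nodal e j.*2 (e j.*2)).
      by rewrite lt_def normc_eq0 c0 normc_ge0.
    rewrite -(ler_pM2l p); apply: (le_trans far).
    by rewrite ler_wpM2r ?normc_ge0.
  split; last by move=> i [] /double_inj ->.
  rewrite em normcN c1 nodalN; split=> //.
  rewrite mulf_neq0// -opprD oppr_eq0 -mulr2n -mulr_natl mulf_neq0//.
  by rewrite -normc_eq0 c1 oner_eq0.
split; last by move=> i im; move: (congr1 odd mE); rewrite -im /= !odd_double.
rewrite -mE in e1 pair_e le *.
have pairj i : (i < j)%N -> e i.*2.+1 = - e i.*2.
  by move=> ij; apply: pair_e; lia.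
(* For j = 0 the squared prefix would be no shorter, so the condition on the first point settles
   this case. *)
have [j0|j0] := posnP j.
  rewrite j0; split; first by case: le.
  by rewrite /nodal big_ord0 oner_neq0.
have jm : (j.+1 < m.+1)%N by lia.
have [/(_ _ (ltnSn j))[nj pj] _] := IHn _ jm _ (leja_prefix_half le pairj).
rewrite nodal_double//; split=> //.
by apply/eqP; rewrite -(@pexpr_eq1 _ _ 2) ?normc_ge0// -normcX; apply/eqP.
Qed.

(** * Infinite Leja sequences of the disk and their Lagrange polynomials *)

Definition leja_disk (R : rcfType) (e : nat -> R[i]) : Prop :=
  forall n, leja_prefix n e.

Definition sqlebesgue (R : rcfType) (e : nat -> R[i]) (n : nat) (z : R[i]) :
    R :=
  \sum_(k < n) normc (lagrange e n k z) ^+ 2.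

Lemma leja_disk_normc (R : rcfType) (e : nat -> R[i]) k :
  leja_disk e -> normc (e k) = 1.
Proof. by move=> /(_ k.+1)/leja_prefix_pairs[/(_ k (ltnSn k))[]]. Qed.

Lemma leja_disk_nodal_neq0 (R : rcfType) (e : nat -> R[i]) k :
  leja_disk e -> nodal e k (e k) != 0.
Proof. by move=> /(_ k.+1)/leja_prefix_pairs[/(_ k (ltnSn k))[]]. Qed.

Lemma leja_disk_pairs (R : rcfType) (e : nat -> R[i]) j :
  leja_disk e -> e j.*2.+1 = - e j.*2.
Proof. by move=> /(_ j.*2.+2)/leja_prefix_pairs[_ /(_ j (ltnSn _))]. Qed.

Lemma leja_disk_half (R : rcfType) (e : nat -> R[i]) :
  leja_disk e -> leja_disk (sqhalf e).
Proof.
move=> le n; apply: (leja_prefixW (leqnSn n)).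
apply: leja_prefix_half => // j _.
exact: leja_disk_pairs.
Qed.

Lemma leja_disk_neq (R : rcfType) (e : nat -> R[i]) j k :
  leja_disk e -> j != k -> e j - e k != 0.
Proof.
move=> le; wlog jk : j k / (k < j)%N => [hw|_].
  rewrite neq_ltn => /orP[jk|kj]; last by rewrite hw// gtn_eqF.
  by rewrite -opprB oppr_eq0 hw// gtn_eqF.
exact: nodal_neq (leja_disk_nodal_neq0 j le) jk.
Qed.

Lemma leja_disk_lagrange_double (R : rcfType) (e : nat -> R[i]) n i z :
  leja_disk e -> (i < n)%N ->
  lagrange e n.*2 i.*2 z =
    lagrange (sqhalf e) n i (z ^+ 2) * ((z + e i.*2) / (2 * e i.*2)) /\
  lagrange e n.*2 i.*2.+1 z =
    lagrange (sqhalf e) n i (z ^+ 2) * ((z - e i.*2) / (2 * - e i.*2)).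
Proof.
move=> le i_n; have nz k : e k != 0.
  by rewrite -normc_eq0 leja_disk_normc ?oner_eq0.
have pair_e j : e j.*2.+1 = - e j.*2 by exact: leja_disk_pairs.
have two0 : 2%:R != 0 :> R[i] by rewrite pnatr_eq0.
have neq j : j != i -> e i.*2 ^+ 2 - e j.*2 ^+ 2 != 0.
  by move=> ji; apply: (leja_disk_neq (leja_disk_half le)); rewrite eq_sym.
split.
  rewrite (@lagrange_double _ e n i i.*2) ?i_n//; last by left.
  by move=> j _; exact: neq.
rewrite -pair_e (@lagrange_double _ e n i i.*2.+1) ?i_n//; last by right.
by move=> j _; rewrite pair_e sqrrN; exact: neq.
Qed.

(** * Recursion and linear bound for the sum of squares *)

Lemma normc2 (R : rcfType) : normc (2 : R[i]) = 2.
Proof. by rewrite normcMn ComplexField.Normc.normc1. Qed.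

(** The pair x, -x contributes |z + x|^2 + |z - x|^2 = 2 (|z|^2 + 1), divided by |2x|^2 = 4. *)
Lemma sqlebesgue_double (R : rcfType) (e : nat -> R[i]) n z : leja_disk e ->
  sqlebesgue e n.*2 z =
    (normc z ^+ 2 + 1) / 2 * sqlebesgue (sqhalf e) n (z ^+ 2).
Proof.
move=> le; rewrite /sqlebesgue.
rewrite (sum_double (fun k => normc (lagrange e n.*2 k z) ^+ 2)) mulr_sumr.
apply: eq_bigr => i _.
have [-> ->] := leja_disk_lagrange_double z le (ltn_ord i).
rewrite !ComplexField.Normc.normcM !ComplexField.Normc.normcV.
rewrite !ComplexField.Normc.normcM normcN normc2 leja_disk_normc//.
have := sqr_normc_parallelogram z (e i.*2).
rewrite leja_disk_normc// expr1n => par.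
rewrite !exprMn -mulrDr mulrC -mulrDl par; congr (_ * _); by field.
Qed.

(** The unpaired node c has a Lagrange polynomial of modulus |lam|. Those of a pair x, -x are (U +
    Bx) / (2x) and -(U - Bx) / (2x), where U and B are the two quantities inside the sum; the
    parallelogram identity yields (|U|^2 + |B|^2) / 2. *)
Lemma sqlebesgue_double_succ (R : rcfType) (e : nat -> R[i]) n z :
  leja_disk e -> let c := e n.*2 in let f := sqhalf e in
  let lam := nodal f n (z ^+ 2) / nodal f n (c ^+ 2) in
  sqlebesgue e n.*2.+1 z =
    normc lam ^+ 2 +
    (\sum_(j < n) (normc (z * lagrange f n j (z ^+ 2)
                         - c * lam * lagrange f n j (c ^+ 2)) ^+ 2
                  + normc (lagrange f n.+1 j (z ^+ 2)) ^+ 2)) / 2.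
Proof.
move=> le c f lam; rewrite /sqlebesgue big_ord_recr [LHS]addrC; congr (_ + _).
  rewrite /= lagrange_last /lam -!nodal_double// => j _; exact: leja_disk_pairs.
rewrite (sum_double (fun k => normc (lagrange e n.*2.+1 k z) ^+ 2)) mulr_suml.
apply: eq_bigr => i _.
have i_n := ltn_ord i.
rewrite !lagrangeS ?neq_ltn ?ltn_double ?ltn_Sdouble ?i_n//=.
have [-> ->] := leja_disk_lagrange_double z le i_n.
rewrite leja_disk_pairs//.
(* This rewrites lam l_j(c^2) as a multiple of l_j(z^2), so that [field] can verify both
   decompositions. *)
rewrite -(mulrA c) -lagrange_gap//; last first.
  exact: leja_disk_nodal_neq0 (leja_disk_half le).
rewrite /f /sqhalf -/c; set a := lagrange _ _ _ _; set x := e i.*2.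
have x1 : normc x = 1 by rewrite leja_disk_normc.
have x0 : x != 0 by rewrite -normc_eq0 x1 oner_eq0.
have xc2 : x ^+ 2 - c ^+ 2 != 0.
  by apply: (leja_disk_neq (leja_disk_half le)); rewrite ltn_eqF.
have := xc2; rewrite subr_sqr mulf_eq0 negb_or => /andP[xc xc'].
set U := z * a - _; set B := a * ((z ^+ 2 - c ^+ 2) / _).
have two0 : 2%:R != 0 :> R[i] by rewrite pnatr_eq0.
have -> : a * ((z + x) / (2 * x)) * ((z - c) / (x - c)) = (U + B * x) / (2 * x).
  by rewrite /U /B; field; rewrite x0 xc xc'.
have -> : a * ((z - x) / (2 * - x)) * ((z - c) / (- x - c)) =
    (U - B * x) / (2 * - x).
  by rewrite /U /B; field; rewrite x0 xc xc' -opprD oppr_eq0 xc'.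
clearbody U B; have := sqr_normc_parallelogram U (B * x).
rewrite !ComplexField.Normc.normcM !ComplexField.Normc.normcV.
rewrite !ComplexField.Normc.normcM normcN normc2 x1 !mulr1 => par.
by rewrite !exprMn -mulrDl par; field.
Qed.

Lemma sqlebesgue0 (R : rcfType) (e : nat -> R[i]) z : sqlebesgue e 0 z = 0.
Proof. exact: big_ord0. Qed.

(** For n = 2k+1 the next point is -c: then lam = 1, B = 0 and U = -2c l_j(f_k), so the sum is
    exactly 1 + 2 Q_k(f_k). For n = 2k it is Q_k(f_k). *)
Lemma sqlebesgue_next_le (R : rcfType) (e : nat -> R[i]) n :
  leja_disk e -> sqlebesgue e n (e n) <= n%:R.
Proof.
elim/ltn_ind: n e => n IHn e le.
have lef := leja_disk_half le.
have := odd_double_half n; case: (odd n) => /=;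
  set k := n./2; rewrite ?add1n ?add0n => nE.
- have kn : (k < n)%N by lia.
  rewrite -nE sqlebesgue_double_succ// leja_disk_pairs// sqrrN.
  rewrite -/(sqhalf e k) divff ?(leja_disk_nodal_neq0 k lef)//.
  rewrite ComplexField.Normc.normc1 expr1n.
  under eq_bigr => j _.
    rewrite (lagrangeS _ _ (negbT (ltn_eqF (ltn_ord j)))) subrr mul0r mulr0.
    rewrite ComplexField.Normc.normc0 expr0n addr0 mulr1.
    rewrite -mulrBl -opprD -mulr2n -mulr_natl.
    rewrite !ComplexField.Normc.normcM normcN ComplexField.Normc.normcM normc2.
    rewrite leja_disk_normc// mulr1 exprMn.
    over.
  rewrite -mulr_sumr; have := IHn k kn (sqhalf e) lef; rewrite /sqlebesgue.
  set s := \sum_(j < k) _; rewrite -[k.*2.+1]addn1 natrD -muln2 natrM; lra.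
have [n0|n0] := posnP n; first by rewrite n0 sqlebesgue0.
have kn : (k < n)%N by lia.
rewrite -nE sqlebesgue_double// leja_disk_normc// -/(sqhalf e k).
have := IHn k kn (sqhalf e) lef.
have : 0 <= k%:R :> R by [].
rewrite -muln2 natrM; set s := sqlebesgue _ _ _; nra.
Qed.

Lemma sqlebesgue_le (R : rcfType) (e : nat -> R[i]) n z :
  leja_disk e -> normc z <= 1 -> sqlebesgue e n z <= 2 * n%:R.
Proof.
elim/ltn_ind: n e z => n IHn e z le z1.
have lef := leja_disk_half le; set f := sqhalf e in lef.
have w1 : normc (z ^+ 2) <= 1 by rewrite normcX exprn_ile1 ?normc_ge0.
have zz1 : normc z ^+ 2 <= 1 by rewrite exprn_ile1 ?normc_ge0.
have := odd_double_half n; case: (odd n) => /=;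
  set k := n./2; rewrite ?add1n ?add0n => nE; last first.
  have [n0|n0] := posnP n; first by rewrite n0 sqlebesgue0 mulr0.
  have kn : (k < n)%N by lia.
  rewrite -nE sqlebesgue_double//.
  have := IHn k kn f _ lef w1.
  have : 0 <= sqlebesgue f k (z ^+ 2) by apply: sumr_ge0 => j _; exact: sqr_ge0.
  have : 0 <= k%:R :> R by [].
  rewrite -muln2 natrM -/f; set s := sqlebesgue _ _ _; nra.
rewrite -nE sqlebesgue_double_succ// -/(sqhalf e k) -/f.
set lam := _ / _; set c := e k.*2.
have c1 : normc c = 1 by exact: leja_disk_normc.
(* f_k maximizes the modulus of [nodal f k] on the disk. *)
have lam1 : normc lam ^+ 2 <= 1.
  rewrite exprn_ile1 ?normc_ge0//.
  rewrite ComplexField.Normc.normcM ComplexField.Normc.normcV.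
  rewrite ler_pdivrMr ?mul1r; first by have [_ _] := lef k.+1; exact.
  by rewrite lt_def normc_eq0 normc_ge0 leja_disk_nodal_neq0.
(* The induction hypothesis at k+1 requires k+1 < 2k+1, hence k > 0. *)
clearbody lam; have [k0|k0] := posnP k.
  by rewrite k0 big_ord0 mul0r addr0 double0 mulr1 (le_trans lam1)// ler1n.
have kn : (k < n)%N by lia.
have kn1 : (k.+1 < n)%N by lia.
have := IHn k kn f _ lef w1; have := IHn k.+1 kn1 f _ lef w1.
have := sqlebesgue_next_le k lef.
rewrite {2}/sqlebesgue big_ord_recr /=.
set q := sqlebesgue f k (f k); set Q := sqlebesgue f k (z ^+ 2).
set Q1 := \sum_(j < k) _; have := sqr_ge0 (normc (lagrange f k.+1 k (z ^+ 2))).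
set last := normc _ ^+ 2.
have : \sum_(j < k) (normc (z * lagrange f k j (z ^+ 2)
                         - c * lam * lagrange f k j (f k)) ^+ 2
                  + normc (lagrange f k.+1 j (z ^+ 2)) ^+ 2)
       <= 2 * (Q + q) + Q1.
  rewrite big_split lerD2r /Q /q /sqlebesgue -big_split mulr_sumr.
  apply: ler_sum => j _; apply: (le_trans (sqr_normcD_le _ _)).
  rewrite ler_pM2l//. rewrite lerD// ?normcN !ComplexField.Normc.normcM !exprMn.
    by rewrite ler_piMl ?sqr_ge0.
  by rewrite c1 expr1n mul1r ler_piMl ?sqr_ge0.
set S := \sum_(j < k) _.
(* With q <= k, Q <= 2k and Q1 <= 2(k+1), the total is at most 1 + 3k + (k+1) = 2(2k+1). *)
rewrite -[k.+1]addn1 -[k.*2.+1]addn1 !natrD -muln2 natrM; lra.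
Qed.

Lemma sum_normc_lagrange_le (R : rcfType) (e : nat -> R[i]) n z :
  leja_disk e -> normc z <= 1 ->
  \sum_(k < n) normc (lagrange e n k z) <= 3 / 2 * n%:R.
Proof.
move=> le z1; have := sqlebesgue_le n le z1.
have : \sum_(k < n) normc (lagrange e n k z) <=
       \sum_(k < n) (1 + normc (lagrange e n k z) ^+ 2) / 2.
  apply: ler_sum => k _; set x := normc _; have := sqr_ge0 (x - 1); nra.
rewrite -mulr_suml big_split /= sumr_const card_ord -/(sqlebesgue e n z); lra.
Qed.

(** * From Leja sequences as defined to the Lebesgue constant *)

Lemma boundary_disk_normc (R : realType) (z : R[i]) :
  closed_unit_disk R z -> boundary (closed_unit_disk R : set R[i]^o) z ->
  normc z = 1.
Proof.
move=> zD [_ zint]; apply/eqP; rewrite eq_le zD /= leNgt; apply/negP => z1.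
(* By the triangle inequality, the ball of radius 1 - |z| around z stays in the disk. *)
apply: zint; apply/nbhs_ballP; exists (1 - normc z)%:C%C.
  by rewrite /= ltcR subr_gt0.
rewrite -ball_normE => y /=; rewrite ltcR -/(normc _) => zy.
rewrite /closed_unit_disk /=; have := le_normcD z (y - z).
rewrite addrC subrK -[normc (y - z)]normcN opprB => yle.
by apply: (le_trans yle); rewrite addrC -lerBrDr ltW.
Qed.

Lemma leja_sequence_disk (R : realType) (eta : nat -> R[i]) :
  leja_sequence (closed_unit_disk R) eta -> leja_disk (fun j => eta j.+1).
Proof.
move=> [etaD eta1 etamax] n; split.
- exact: boundary_disk_normc (etaD _ _) eta1.
- by move=> k _; exact: etaD.
move=> [|k] z _ z1; first by rewrite /nodal !big_ord0.
have prodE y : normc (nodal (fun j => eta j.+1) k.+1 y) =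
    \prod_(1 <= j < k.+2) normc (y - eta j).
  by rewrite normc_prod big_add1 big_mkord.
rewrite !prodE -lee_fin -etamax//; apply: ereal_sup_ubound.
by exists z.
Qed.

Lemma fund_lagrangeE (R : realType) (eta : nat -> R[i]) N k z :
  fund_lagrange eta N k.+1 z = lagrange (fun j => eta j.+1) N k z.
Proof.
rewrite /fund_lagrange big_mkcond big_add1 big_mkord.
by apply: eq_bigr => j _; rewrite eqSS; case: eqP.
Qed.

(** The lower bound, from the value at z = 0, combines with the upper one to make the supremum
    finite, so [fine] returns its real value. *)
Lemma lebesgue_constant_disk_le (R : realType) (eta : nat -> R[i]) N :
  leja_sequence (closed_unit_disk R) eta ->
  (0 <= lebesgue_constant (closed_unit_disk R) eta N <= (3 / 2 * N%:R)%:E)%E.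
Proof.
move=> /leja_sequence_disk le; apply/andP; split.
  apply: (@le_trans _ _
      (\sum_(1 <= k < N.+1) normc (fund_lagrange eta N k 0))%:E).
    by rewrite lee_fin sumr_ge0// => k _; exact: normc_ge0.
  apply: ereal_sup_ubound; exists 0 => //.
  by rewrite /closed_unit_disk /mkset ComplexField.Normc.normc0.
apply: ge_ereal_sup => _ [z z1 <-]; rewrite lee_fin big_add1 big_mkord.
under eq_bigr do rewrite fund_lagrangeE.
exact: sum_normc_lagrange_le.
Qed.

Theorem corollary1 (R : realType) (eta : nat -> R[i])
    (heta : leja_sequence (closed_unit_disk R) eta) :
  (forall N : nat, (1 <= N)%N ->
     (lebesgue_constant (closed_unit_disk R) eta N
        <= (pi * expR (3 * pi) * N%:R)%:E)%E)
  /\ (fun N : nat => fine (lebesgue_constant (closed_unit_disk R) eta N))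
       =O_\oo (fun N : nat => N%:R : R).
Proof.
split=> [N _|].
  have /andP[_ /le_trans] := lebesgue_constant_disk_le N heta; apply.
  rewrite lee_fin ler_wpM2r//.
  (* pi >= 2 and exp(3 pi) >= 1 + 3 pi make the constant at least 14, above 3/2. *)
  have pi2 := pi_ge2 R; have := expR_ge1Dx (3 * pi : R); nra.
apply/eqO_exP; exists (3 / 2) => //; near=> N.
have /andP[L0 LN] := lebesgue_constant_disk_le N heta.
rewrite ger0_norm ?fine_ge0// normr_nat -lee_fin fineK//.
by rewrite ge0_fin_numE// (le_lt_trans LN) ?ltry.
Unshelve. all: by end_near.
Qed.
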